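(* Consider the family, indexed by $N>1$, of stationary Markov-modulated multi-class DPS queues described in the context. If the limits $\hat P_d(\boldsymbol s):=\lim_{N\to\infty}P_d^{(N)}(e^{-\boldsymbol s/N})$ exist (for every $d\in\{1,\ldots,D\}$ and $\boldsymbol s\ge\boldsymbol0$), then the joint queue length distribution is independent of the environment in heavy traffic, that is, with $\hat P(\boldsymbol s):=\sum_{d=1}^D\hat P_d(\boldsymbol s)$, $$\hat P_d(\boldsymbol s)=\pi_d\,\hat P(\boldsymbol s)\qquad\text{for all } d \text{ and } \boldsymbol s\ge\boldsymbol 0.$$
   Context: Model. The environment $Z$ is an irreducible continuous-time Markov chain on $\{1,\ldots,D\}$ with generator $Q=(q_{d\ell})_{d,\ell=1}^D$ and invariant distribution $\boldsymbol{\pi}=(\pi_1,\ldots,\pi_D)$; it evolves autonomously. There are $K$ customer classes with weights $g_k>0$. When the environment is in state $d$, class-$k$ customers arrive as independent Poisson processes of rate $\lambda_{k,d}\ge0$; for each $k$, $\lambda_{k,d}>0$ for at least one $d$. Class-$k$ service requirements are exponential with mean $1/\mu_k$. The server has capacity $c_d>0$ while the environment is in state $d$; write $\mu_{k,d}:=\mu_kc_d$. Under discriminatory processor sharing (DPS), each class-$k$ customer receives the fraction $g_k/\sum_jg_jM_j$ of the capacity, where $M_j$ is the number of class-$j$ customers present. Hence $(M_1,\ldots,M_K,Z)$ is a continuous-time Markov chain: from $(\boldsymbol m,d)$ it jumps to $(\boldsymbol m+\boldsymbol e_k,d)$ at rate $\lambda_{k,d}$, to $(\boldsymbol m-\boldsymbol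 e_k,d)$ at rate $\mu_{k,d}\,g_km_k/\sum_jg_jm_j$ (if $m_k>0$), and to $(\boldsymbol m,\ell)$, $\ell\ne d$, at rate $q_{d\ell}$. Heavy-traffic scaling. Put $c_\infty:=\sum_d\pi_dc_d$, $\lambda_{k,\infty}:=\sum_d\pi_d\lambda_{k,d}$, $\mu_{k,\infty}:=\mu_kc_\infty$, $\rho_\infty:=\sum_k\lambda_{k,\infty}/\mu_{k,\infty}$. In the $N$-th system ($N>1$) the arrival rates are $\lambda_{k,d}^{(N)}:=\frac{\lambda_{k,d}}{\rho_\infty}(1-1/N)$; all other parameters are unchanged, so its load is $1-1/N$. $(M_1^{(N)},\ldots,M_K^{(N)},Z)$ denotes the steady state of the $N$-th system, and $$P_d^{(N)}(\boldsymbol z):=\mathbb E\left[z_1^{M_1^{(N)}}\cdots z_K^{M_K^{(N)}}\mathbf 1_{\{Z=d\}}\right],\qquad e^{-\boldsymbol s/N}:=(e^{-s_1/N},\ldots,e^{-s_K/N}).$$ *)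

(* Defs.v *)
From mathcomp Require Import all_boot all_order all_algebra.
From mathcomp Require Import all_classical all_reals all_analysis.

Set Implicit Arguments.
Unset Strict Implicit.
Unset Printing Implicit Defensive.

Import Order.TTheory GRing.Theory Num.Theory.
Import numFieldNormedType.Exports.

Local Open Scope classical_set_scope.
Local Open Scope ring_scope.

Definition is_generator (R : realType) (D : nat) (Q : 'M[R]_D) : Prop :=
  (forall d l, d != l -> 0 <= Q d l) /\ (forall d, \sum_l Q d l = 0).

Definition irreducible_generator (R : realType) (D : nat) (Q : 'M[R]_D) : Prop :=
  forall d l, connect [rel i j | 0 < Q i j] d l.

Definition invariant_distribution (R : realType) (D : nat)
    (pi : 'rV[R]_D) (Q : 'M[R]_D) : Prop :=
  [/\ forall d, 0 <= pi 0 d, \sum_d pi 0 d = 1 & pi *m Q = 0].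

(* Invariance of the law [p] for the continuous-time Markov chain with jump
   rates [q x y] from [x] to [y != x]: in every state the probability flow in
   equals the probability flow out.  It is used only for chains whose total
   jump rate is bounded over the states, hence non-explosive. *)
Definition stationary_law (R : realType) (T : choiceType)
    (q : T -> T -> R) (p : T -> \bar R) : Prop :=
  forall x,
    (\esum_(y in ~` [set x]) (p y * (q y x)%:E)
     = p x * \esum_(y in ~` [set x]) (q x y)%:E)%E.

Record dps_params (R : realType) (K D : nat) := DpsParams {
  env_gen  : 'M[R]_D ;
  arrival  : 'I_K -> 'I_D -> R ;
  mu       : 'I_K -> R ;
  weight   : 'I_K -> R ;
  capacity : 'I_D -> R }.

Definition dps_state (K D : nat) : Type := ({ffun 'I_K -> nat} * 'I_D)%type.

Section Dps.
Variables (R : realType) (K D : nat).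

Definition service_rate (S : dps_params R K D) (k : 'I_K) (d : 'I_D) : R :=
  mu S k * capacity S d.

Definition add_customer (k : 'I_K) (x : dps_state K D) : dps_state K D :=
  ([ffun j => (x.1 j + (j == k))%N], x.2).

(* A departure of class [k] leads from [x] to [y] exactly when adding a class
   [k] customer to [y] gives [x]; this forces [0 < x.1 k], so that the
   denominator below is positive. *)
Definition dps_rate (S : dps_params R K D) (x y : dps_state K D) : R :=
  \sum_(k < K) (if y == add_customer k x then arrival S k x.2 else 0)
  + \sum_(k < K) (if x == add_customer k y then
      service_rate S k x.2 * (weight S k * (x.1 k)%:R
                              / \sum_(j < K) weight S j * (x.1 j)%:R)
    else 0)
  + (if (x.1 == y.1) && (x.2 != y.2) then env_gen S x.2 y.2 else 0).

Definition capacity_inf (pi : 'rV[R]_D) (S : dps_params R K D) : R :=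
  \sum_d pi 0 d * capacity S d.

Definition arrival_inf (pi : 'rV[R]_D) (S : dps_params R K D) (k : 'I_K) : R :=
  \sum_d pi 0 d * arrival S k d.

Definition mu_inf (pi : 'rV[R]_D) (S : dps_params R K D) (k : 'I_K) : R :=
  mu S k * capacity_inf pi S.

Definition rho_inf (pi : 'rV[R]_D) (S : dps_params R K D) : R :=
  \sum_k arrival_inf pi S k / mu_inf pi S k.

Definition scaled_params (pi : 'rV[R]_D) (S : dps_params R K D) (N : nat) :
    dps_params R K D :=
  DpsParams (env_gen S)
    (fun k d => arrival S k d / rho_inf pi S * (1 - 1 / N%:R))
    (mu S) (weight S) (capacity S).

Section RandomState.
Context {disp : measure_display} {Omega : measurableType disp}.
Variables (P : probability Omega R) (M : 'I_K -> {RV P >-> nat})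
  (Z : Omega -> 'I_D).

Definition joint_state (w : Omega) : dps_state K D := ([ffun k => M k w], Z w).

(* ['I_D] carries no sigma-algebra in the library, so the measurability of [Z]
   is required on its (finitely many) level sets. *)
Definition steady_state (S : dps_params R K D) : Prop :=
  (forall d, measurable (Z @^-1` [set d])) /\
  stationary_law (dps_rate S) (fun x => P (joint_state @^-1` [set x])).

Definition joint_gf (d : 'I_D) (z : 'I_K -> R) : R :=
  fine ('E_P[fun w => ((\prod_k z k ^+ M k w) * \1_(Z @^-1` [set d]) w)%R])%E.

End RandomState.

End Dps.

(* Main.v *)
(* Test the stationarity of the chain against h(m, l) = z^m 1_{l = d}.  Arrivals
   and departures change h by at most 1 - z_k, so they contribute
   O(sum_k (1 - z_k)), and what is left is the action of the environment:
   |sum_l P_l(z) q_{ld}| = O(sum_k (1 - z_k)).  With z_k = exp(- s_k / N) the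
   bound is O(1 / N), hence the limit row (Phat_l(s))_l is annihilated by Q.  By
   irreducibility the left kernel of Q is spanned by pi, and summing the entries
   identifies the factor. *)
Require Import Defs.
From mathcomp Require Import all_boot all_order all_algebra.
From mathcomp Require Import all_classical all_reals all_analysis.
From mathcomp Require Import measurable_realfun.
Set Implicit Arguments.
Unset Strict Implicit.
Unset Printing Implicit Defensive.
Import Order.TTheory GRing.Theory Num.Theory.
Import numFieldNormedType.Exports.
Local Open Scope classical_set_scope.
Local Open Scope ring_scope.

(** * Left kernel of an irreducible generator *)

(** If [w] vanishes at [d], the entry of [w *m Q] at [d] is a sum of nonnegative terms, so [w]
    vanishes at every predecessor of [d]. Zeros thus spread backwards along paths, and every state
    has a path to [d0]. *)
Lemma irreducible_null (R : realType) (D : nat) (Q : 'M[R]_D) (w : 'rV[R]_D) d0 :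
  is_generator Q -> irreducible_generator Q -> (forall d, 0 <= w 0 d) ->
  w *m Q = 0 -> w 0 d0 = 0 -> w = 0.
Proof.
move=> [Qge0 _] irr w0 wQ wd0.
have pred_null l d : 0 < Q l d -> w 0 d = 0 -> w 0 l = 0.
  move=> Qld wd; have [->//|ld] := eqVneq l d.
  have /matrixP/(_ 0 d) := wQ; rewrite !mxE => /eqP.
  rewrite psumr_eq0 => [/allP/(_ l)|i _]; last first.
    have [->|] := eqVneq i d; first by rewrite wd mul0r.
    by move=> id; rewrite mulr_ge0// Qge0.
  rewrite mem_index_enum => /(_ isT)/=; rewrite mulf_eq0 (gt_eqF Qld) orbF.
  by move/eqP.
apply/rowP => l; rewrite !mxE.
have /connectP[p pp dl] := irr l d0; elim: p l pp dl => [|x p IH] l /=.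
  by move=> _ <-.
by move=> /andP[Qlx px] /(IH _ px); exact: pred_null.
Qed.

(* Subtract from [v] the multiple of [pi] by the least ratio [v_d / pi_d]: the
   result is a nonnegative invariant vector with a zero entry. *)
Lemma invariant_unique (R : realType) (D : nat) (Q : 'M[R]_D) (pi v : 'rV[R]_D) :
  is_generator Q -> irreducible_generator Q -> invariant_distribution pi Q ->
  v *m Q = 0 -> v = (\sum_d v 0 d) *: pi.
Proof.
move=> gen irr [pi0 pi1 piQ] vQ.
(* The ratios [v 0 d / pi 0 d] need positive denominators; a zero entry would force [pi = 0],
   against total mass 1. *)
have pi_gt0 d : 0 < pi 0 d.
  rewrite lt_def pi0 andbT; apply/eqP => pid.
  have pi_eq0 := irreducible_null gen irr pi0 piQ pid.
  move: pi1; rewrite pi_eq0 big1 => [/eqP|i _]; last by rewrite mxE.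
  by rewrite eq_sym oner_eq0.
have [d1|noD] := pickP 'I_D; last by apply/rowP => d; have := noD d.
have [d0 _ dmin] := @arg_minP _ _ _ d1 xpredT (fun d => v 0 d / pi 0 d) isT.
set c := v 0 d0 / pi 0 d0 in dmin.
(* Summing the entries of [c *: pi] identifies [c] with the total mass of [v]. *)
suff vE : v = c *: pi.
  by rewrite vE (eq_bigr _ (fun d _ => mxE _ _ _ _)) -mulr_sumr pi1 mulr1.
apply/eqP; rewrite -subr_eq0; apply/eqP.
apply: (@irreducible_null _ _ _ _ d0 gen irr).
- by move=> d; rewrite !mxE subr_ge0 -ler_pdivlMr// dmin.
- by rewrite mulmxBl vQ -scalemxAl piQ scaler0 subr0.
- by rewrite !mxE /c divfK ?subrr// gt_eqF.
Qed.

(** * Sums of nonnegative extended reals *)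

Section esum_lemmas.
Context {R : realType}.
Local Open Scope ereal_scope.

Lemma ge0_esumZl (T : choiceType) (A : set T) (a : T -> \bar R) (r : R) :
  (0 <= r)%R -> (forall x, 0 <= a x) ->
  \esum_(x in A) (r%:E * a x) = r%:E * \esum_(x in A) a x.
Proof.
move=> r0 a0; rewrite /esum -ereal_supZl//; last first.
  apply/set0P; exists (\sum_(i \in set0) a i); exists set0 => //.
  exact: fsets_set0.
rewrite image_comp; congr ereal_sup; apply: eq_imagel => F _ /=.
by rewrite ge0_mule_fsumr.
Qed.

Lemma esum_exchange (T T' : choiceType) (a : T -> T' -> \bar R) :
  (forall x y, 0 <= a x y) ->
  \esum_(x in setT) \esum_(y in setT) a x y =
  \esum_(y in setT) \esum_(x in setT) a x y.
Proof.
move=> a0; rewrite !esum_esum//.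
pose swap (z : T' * T) := (z.2, z.1).
rewrite (@reindex_esum _ _ _ (setT `*`` fun=> setT) _ swap)//.
split => [//|[? ?] [? ?] _ _ [-> ->]//|[x y] _].
by exists (y, x).
Qed.

(** Chain rates vanish on the diagonal, so the punctured sums in [stationary_law] can be taken over
    all states. *)
Lemma esum_setC1 (T : choiceType) (a : T -> \bar R) x : a x = 0 ->
  \esum_(y in ~` [set x]) a y = \esum_(y in setT) a y.
Proof.
move=> ax0; rewrite esum_mkcond; apply: eq_esum => y _.
case: ifPn => //; rewrite notin_setE /= => /contrapT ->.
by [].
Qed.

Lemma esum_eq1 (T : choiceType) (x : T) (r : T -> \bar R) : 0 <= r x ->
  \esum_(y in setT) (if y == x then r y else 0) = r x.
Proof.
move=> r0; rewrite -[RHS](@esum_set1 _ _ x)// [RHS]esum_mkcond.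
by apply: eq_esum => y _; rewrite in_set1.
Qed.

End esum_lemmas.

(** * Balance equations tested against a nonnegative function *)

Section stationary_test_function.
Context {R : realType} {T : choiceType} {I : finType}.
Variables (q : T -> T -> R) (t : I -> T -> T) (c : I -> T -> R).
Hypothesis qE : forall x y, q x y = \sum_i (if y == t i x then c i x else 0).
Hypothesis c_ge0 : forall i x, 0 <= c i x.
Hypothesis q_diag : forall x, q x x = 0.

Let q_ge0 x y : 0 <= q x y.
Proof. by rewrite qE sumr_ge0// => i _; case: ifP. Qed.

(** Each index in [I] is a kind of jump with one determined target, so a sum over all destinations
    collapses to a finite sum over kinds; kinds with a common target add up. *)
Lemma esum_branching (h : T -> R) x : (forall y, 0 <= h y) ->
  \esum_(y in setT) (q x y * h y)%:E = (\sum_i c i x * h (t i x))%:E.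
Proof.
move=> h0.
under eq_esum do rewrite qE mulr_suml -sumEFin.
rewrite esum_sum => [|y i _ _]; last first.
  by rewrite lee_fin mulr_ge0//; case: ifP.
rewrite -sumEFin; apply: eq_bigr => i _.
rewrite -(@esum_eq1 _ _ (t i x) (fun y => (c i x * h y)%:E)); last first.
  by rewrite lee_fin mulr_ge0.
by apply: eq_esum => y _; case: ifP; rewrite ?mul0r.
Qed.

(** Multiply the balance equation at [x] by [h x] and sum over [x]. All terms are nonnegative, so
    the double sum on the inflow side may be exchanged in the extended reals. *)
Lemma stationary_law_test (p h : T -> R) :
  stationary_law q (EFin \o p) -> (forall x, 0 <= p x) -> (forall x, 0 <= h x) ->
  \esum_(x in setT) (p x * \sum_i c i x * h (t i x))%:E =
  \esum_(x in setT) (p x * (h x * \sum_i c i x))%:E.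
Proof.
move=> stat p0 h0.
transitivity (\esum_(y in setT) \esum_(x in setT) (p y * (q y x * h x))%:E).
  apply: eq_esum => y _; rewrite EFinM -esum_branching//.
  rewrite -ge0_esumZl// => x; first by rewrite lee_fin mulr_ge0.
rewrite esum_exchange => [|y x]; last by rewrite lee_fin !mulr_ge0.
apply: eq_esum => x _.
transitivity ((h x)%:E * \esum_(y in setT) (p y * q y x)%:E)%E.
  rewrite -ge0_esumZl// => [|y]; last by rewrite lee_fin mulr_ge0.
  by apply: eq_esum => y _; rewrite -EFinM mulrA mulrC.
(* Balance at [x] replaces the inflow by [p x] times the total outflow rate. *)
have := stat x; rewrite !esum_setC1 ?q_diag//= ?mule0// => ->.
have -> : \esum_(y in setT) (q x y)%:E = (\sum_i c i x)%:E.
  have := @esum_branching (fun=> 1) x (fun=> ler01).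
  under eq_bigr do rewrite mulr1.
  by move=> <-; apply: eq_esum => y _; rewrite mulr1.
by rewrite -!EFinM mulrCA.
Qed.

End stationary_test_function.

(** * Expectations of functions of a countably valued random element *)

Section discrete_random_element.
Context {R : realType} {disp : measure_display} {Omega : measurableType disp}.
Context {T : countType} (P : probability Omega R) (X : Omega -> T).
Hypothesis mX : forall x, measurable (X @^-1` [set x]).

Lemma measurable_discrete_preimage (A : set T) : measurable (X @^-1` A).
Proof.
rewrite [X in measurable X](_ : _ =
    \bigcup_x (if x \in A then X @^-1` [set x] else set0)).
  apply: countable_bigcupT_measurable => [|x]; first exact: countableP.
  by case: ifP.
apply/seteqP; split => w /=.
  by move=> Aw; exists (X w) => //; rewrite mem_set.
by move=> [x _]; case: ifPn => //; rewrite inE /= => Ax ->.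
Qed.

Lemma measurable_discrete_comp (g : T -> R) : measurable_fun setT (g \o X).
Proof.
by move=> _ B mB; rewrite setTI comp_preimage; exact: measurable_discrete_preimage.
Qed.

Lemma integrable_discrete_comp (g : T -> R) (C : R) :
  (forall x, `|g x| <= C) -> P.-integrable setT (EFin \o (g \o X)).
Proof.
move=> gC; apply: measurable_bounded_integrable => //.
- by rewrite -ge0_fin_numE// fin_num_measure.
- exact: measurable_discrete_comp.
- exists C; split; first by rewrite num_real.
  by move=> C' /ltW CC' w _; exact: le_trans (gC _) CC'.
Qed.

Lemma ge0_expectation_discrete (g : T -> R) : (forall x, 0 <= g x) ->
  (\int[P]_w (g (X w))%:E =
   \esum_(x in setT) (fine (P (X @^-1` [set x])) * g x)%:E)%E.
Proof.
move=> g0.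
(* The sample space is cut along the codes of the states, which turns the integral into a series
   over [nat]. *)
pose F n := X @^-1` [set x | pickle x = n].
have UF : \bigcup_n F n = setT.
  by apply/seteqP; split => // w _; exists (pickle (X w)).
rewrite -UF ge0_integral_bigcup.
- rewrite nneseries_esumT => [|n]; last by apply: integral_ge0 => w _; rewrite lee_fin.
  rewrite [RHS](_ : _ = \esum_(x in \bigcup_n [set x : T | pickle x = n])
     (fine (P (X @^-1` [set x])) * g x)%:E); last first.
    by congr esum; apply/seteqP; split => // x _; exists (pickle x).
  rewrite esum_bigcupT; last 2 first.
  + by move=> n m _ _ [x /= [<- <-]].
  + by move=> x; rewrite lee_fin mulr_ge0// fine_ge0.
  apply: eq_esum => n _; rewrite /F.
  (* By injectivity of [pickle] a code belongs to one state, where the integrand is constant, or to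
     none, where the piece is empty. *)
  have [[x xn]|nox] := pselect (exists x : T, pickle x = n).
    rewrite (_ : [set y : T | pickle y = n] = [set x]); last first.
      apply/seteqP; split => y /=; last by move=> ->.
      by rewrite -xn => /(pcan_inj pickleK).
    rewrite esum_set1; last by rewrite lee_fin mulr_ge0// fine_ge0.
    rewrite (eq_integral (cst (g x)%:E)).
      rewrite integral_cst; last exact: mX.
      by rewrite EFinM fineK; [rewrite muleC|apply: fin_num_measure; exact: mX].
    by move=> w; rewrite inE /= => ->.
  rewrite (_ : [set y : T | pickle y = n] = set0); last first.
    by apply/seteqP; split => // y /= yn; apply: nox; exists y.
  by rewrite preimage_set0 integral_set0 esum_set0.
- by move=> n; exact: measurable_discrete_preimage.
- rewrite UF; apply/measurable_EFinP; exact: measurable_discrete_comp.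
- by move=> w _; rewrite lee_fin.
- by move=> n m _ _ [w /= [<- <-]].
Qed.

End discrete_random_element.

Lemma Rintegral_sum {R : realType} {disp} {Omega : measurableType disp}
    (mu : {measure set Omega -> \bar R}) (I : finType) (f : I -> Omega -> R) :
  (forall i, mu.-integrable setT (EFin \o f i)) ->
  \int[mu]_w (\sum_i f i w) = \sum_i \int[mu]_w f i w.
Proof.
move=> intf; rewrite /Rintegral sum_fine => [|i _]; last first.
  by apply: integrable_fin_num => //; exact: intf.
rewrite -integral_sum//; congr fine; apply: eq_integral => w _.
by rewrite sumEFin.
Qed.

(** * Vanishing mean of the generator under a stationary law *)

Section generator_identity.
Context {R : realType} {disp : measure_display} {Omega : measurableType disp}.
Context {T : countType} (P : probability Omega R) (X : Omega -> T).
Hypothesis mX : forall x, measurable (X @^-1` [set x]).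
Context {I : finType} (q : T -> T -> R) (t : I -> T -> T) (c : I -> T -> R).
Hypothesis qE : forall x y, q x y = \sum_i (if y == t i x then c i x else 0).
Hypothesis c_ge0 : forall i x, 0 <= c i x.
Hypothesis c_bounded : forall i, exists C, forall x, c i x <= C.
Hypothesis q_diag : forall x, q x x = 0.
Hypothesis stat : stationary_law q (fun x => P (X @^-1` [set x])).

(** The integrand is the generator applied to [h]. Bounded intensities make its gain part [g1] and
    loss part [g2] separately integrable, so the equality of their means, given by
    [stationary_law_test], can be subtracted. *)
Lemma stationary_generator (h : T -> R) : (forall x, 0 <= h x <= 1) ->
  \int[P]_w (\sum_i c i (X w) * (h (t i (X w)) - h (X w))) = 0.
Proof.
move=> h01.
have h0 x : 0 <= h x by case/andP: (h01 x).
have h1 x : h x <= 1 by case/andP: (h01 x).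
have [C cC] := choice c_bounded.
pose g1 x := \sum_i c i x * h (t i x).
pose g2 x := h x * \sum_i c i x.
have g1_ge0 x : 0 <= g1 x by rewrite sumr_ge0// => i _; rewrite mulr_ge0.
have g2_ge0 x : 0 <= g2 x by rewrite mulr_ge0// sumr_ge0.
have int1 : P.-integrable setT (EFin \o (g1 \o X)).
  apply: (@integrable_discrete_comp _ _ _ _ _ _ mX _ (\sum_i C i)) => x.
  rewrite ger0_norm//; apply: ler_sum => i _.
  by rewrite (le_trans _ (cC i x))// ler_piMr.
have int2 : P.-integrable setT (EFin \o (g2 \o X)).
  apply: (@integrable_discrete_comp _ _ _ _ _ _ mX _ (\sum_i C i)) => x.
  rewrite ger0_norm// (@le_trans _ _ (\sum_i c i x))//; last exact: ler_sum.
  by rewrite ler_piMl// sumr_ge0.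
transitivity (\int[P]_w (g1 (X w) - g2 (X w))).
  apply: eq_Rintegral => w _; rewrite /g1 /g2 mulr_sumr -sumrB.
  by apply: eq_bigr => i _; rewrite mulrBr [h _ * _]mulrC.
rewrite RintegralB// /Rintegral !ge0_expectation_discrete//.
pose p x := fine (P (X @^-1` [set x])).
rewrite (@stationary_law_test _ _ _ _ _ _ qE c_ge0 q_diag p)// ?subrr//.
- rewrite [EFin \o p](_ : _ = (fun x => P (X @^-1` [set x])))//.
  by apply/funext => x; rewrite /= fineK// fin_num_measure.
- by move=> x; rewrite fine_ge0.
Qed.

End generator_identity.

(** * The DPS chain as a finite family of jumps *)

Section dps_generator.
Context {R : realType} {K D : nat} (S : dps_params R K D).
Local Notation state := (dps_state K D).

Definition remove_customer (k : 'I_K) (x : state) : state :=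
  ([ffun j => (x.1 j - (j == k))%N], x.2).

Definition dps_target (i : 'I_K + 'I_K + 'I_D) (x : state) : state :=
  match i with
  | inl (inl k) => add_customer k x
  | inl (inr k) => remove_customer k x
  | inr l => (x.1, l)
  end.

Definition dps_share (k : 'I_K) (x : state) : R :=
  weight S k * (x.1 k)%:R / \sum_(j < K) weight S j * (x.1 j)%:R.

(* [dps_share k x] vanishes when [x] has no class [k] customer, so the truncated
   subtraction in [remove_customer] creates no spurious jump. *)
Definition dps_intensity (i : 'I_K + 'I_K + 'I_D) (x : state) : R :=
  match i with
  | inl (inl k) => arrival S k x.2
  | inl (inr k) => service_rate S k x.2 * dps_share k x
  | inr l => if x.2 != l then env_gen S x.2 l else 0
  end.

Lemma dps_share0 k (x : state) : x.1 k = 0%N -> dps_share k x = 0.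
Proof. by rewrite /dps_share => ->; rewrite mulr0 mul0r. Qed.

Lemma remove_customerK k (x : state) :
  x.1 k != 0%N -> add_customer k (remove_customer k x) = x.
Proof.
case: x => m d /= mk; congr pair; apply/ffunP => j; rewrite !ffunE /=.
by case: eqVneq => [->|]; rewrite ?subn0 ?addn0 ?subnK ?lt0n.
Qed.

Lemma add_customerK k (x : state) : remove_customer k (add_customer k x) = x.
Proof. by case: x => m d; congr pair; apply/ffunP => j; rewrite !ffunE addnK. Qed.

Lemma dps_rateE (x y : state) : dps_rate S x y =
  \sum_i (if y == dps_target i x then dps_intensity i x else 0).
Proof.
rewrite /dps_rate big_sumType/= big_sumType/=; congr (_ + _ + _).
  (* [x == add_customer k y] and [y == remove_customer k x] differ only when [x] has no class [k]
     customer, and then the share is zero. *)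
  apply: eq_bigr => k _; case: (eqVneq y (remove_customer k x)) => [->|yx].
    have [xk|xk] := eqVneq (x.1 k) 0%N; last by rewrite remove_customerK ?eqxx.
    by rewrite dps_share0// xk !mulr0 mul0r mulr0; case: ifP.
  case: eqVneq => // xE; move: yx; rewrite xE add_customerK eqxx//.
rewrite (bigD1 y.2)//= big1 => [|l ly]; last first.
  case: y ly => m d /= ld.
  by rewrite xpair_eqE [d == l]eq_sym (negbTE ld) andbF.
rewrite addr0; case: x y => [m d] [m' d'] /=; rewrite xpair_eqE eqxx andbT eq_sym.
by case: eqP => //= _; case: eqP.
Qed.

Lemma dps_rate_diag (x : state) : dps_rate S x x = 0.
Proof.
have add_neq k : (x == add_customer k x) = false.
  apply/eqP => /(congr1 (fun y : state => y.1 k)); rewrite /= !ffunE eqxx => /eqP.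
  by rewrite -[X in X == _]addn0 eqn_add2l.
rewrite /dps_rate eqxx big1 ?add0r => [|k _]; last by rewrite add_neq.
by rewrite eqxx/= addr0 big1// => k _; rewrite add_neq.
Qed.

End dps_generator.

Lemma ler_sum_term {R : numDomainType} {I : finType} (F : I -> R) i :
  (forall j, 0 <= F j) -> F i <= \sum_j F j.
Proof. by move=> F0; rewrite (bigD1 i)//= lerDl sumr_ge0. Qed.

(** * Bound on the environment balance of the generating functions *)

Section dps_generating_function.
Context {R : realType} {K D : nat} (S : dps_params R K D).
Hypothesis gen_ge0 : forall d l, d != l -> 0 <= env_gen S d l.
Hypothesis gen_sum0 : forall d, \sum_l env_gen S d l = 0.
Hypothesis arrival_ge0 : forall k d, 0 <= arrival S k d.
Hypothesis mu_ge0 : forall k, 0 <= mu S k.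
Hypothesis weight_ge0 : forall k, 0 <= weight S k.
Hypothesis capacity_ge0 : forall d, 0 <= capacity S d.
Local Notation state := (dps_state K D).

Let service_ge0 k d : 0 <= service_rate S k d.
Proof. by rewrite mulr_ge0. Qed.

Lemma dps_share_ge0 k (x : state) : 0 <= dps_share S k x.
Proof. by rewrite divr_ge0 ?mulr_ge0 ?sumr_ge0// => j _; rewrite mulr_ge0. Qed.

Lemma dps_share_le1 k (x : state) : dps_share S k x <= 1.
Proof.
rewrite /dps_share; set s := \sum_j _.
have s_ge : weight S k * (x.1 k)%:R <= s.
  by apply: (ler_sum_term (F := fun j => _ * _)) => j; rewrite mulr_ge0.
(* With a zero denominator, as for an empty system, the share is 0 by the convention on inverses. *)
have [s0|s0] := eqVneq s 0; first by rewrite s0 invr0 mulr0.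
rewrite ler_pdivrMr ?mul1r// lt_def s0.
by rewrite (le_trans _ s_ge)// mulr_ge0.
Qed.

Lemma dps_intensity_ge0 i (x : state) : 0 <= dps_intensity S i x.
Proof.
case: i => [[k|k]|l] //=; first by rewrite mulr_ge0// dps_share_ge0.
by case: ifP => // /gen_ge0.
Qed.

(** Summing over environment states gives bounds uniform in the environment; departures are bounded
    uniformly in the queue lengths because shares are at most 1. *)
Lemma dps_intensity_bounded i : exists C, forall x, dps_intensity S i x <= C.
Proof.
case: i => [[k|k]|l] /=.
- by exists (\sum_d arrival S k d) => x; exact: ler_sum_term.
- exists (\sum_d service_rate S k d) => x.
  rewrite (@le_trans _ _ (service_rate S k x.2))//; last exact: ler_sum_term.
  by rewrite ler_piMr// dps_share_le1.
- exists (\sum_d `|env_gen S d l|) => x; case: ifP => _; last by rewrite sumr_ge0.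
  rewrite (le_trans (ler_norm _))//.
  exact: (ler_sum_term (F := fun d => `|env_gen S d l|)).
Qed.

Context {disp : measure_display} {Omega : measurableType disp}.
Variables (P : probability Omega R) (M : 'I_K -> {RV P >-> nat})
  (Z : Omega -> 'I_D).
Hypothesis steady : steady_state M Z S.
Variable z : 'I_K -> R.
Hypothesis z01 : forall k, 0 <= z k <= 1.
Local Notation X := (joint_state M Z).

Let mX (x : state) : measurable (X @^-1` [set x]).
Proof.
rewrite [X in measurable X](_ : _ =
  (\big[setI/setT]_(k < K) (M k @^-1` [set x.1 k])) `&` (Z @^-1` [set x.2])).
  apply: measurableI; last by case: steady.
  apply: bigsetI_measurable => k _.
  by rewrite -[_ @^-1` _]setTI; exact: (measurable_funP (M k)).
apply/seteqP; split => w /=.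
  move=> <-; split => //=; rewrite -bigcap_seq => k _ /=.
  by rewrite ffunE.
case: x => m d /= []; rewrite -bigcap_seq => Mw <-.
congr pair; apply/ffunP => k; rewrite ffunE; apply: Mw.
by rewrite /= mem_index_enum.
Qed.

Let f (x : state) : R := \prod_k z k ^+ x.1 k.

Let f01 x : 0 <= f x <= 1.
Proof.
have z0 k : 0 <= z k by case/andP: (z01 k).
have z1 k : z k <= 1 by case/andP: (z01 k).
rewrite prodr_ge0 => [/=|k _]; last exact: exprn_ge0.
by rewrite Num.Theory.prodr_ile1// => k _; rewrite exprn_ge0//= exprn_ile1.
Qed.

Let f_add k x : f (add_customer k x) = f x * z k.
Proof.
rewrite /f (bigD1 k)//= [in RHS](bigD1 k)//= ffunE eqxx addn1 exprSr.
rewrite -!mulrA [z k * _]mulrC; congr (_ * (_ * _)).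
by apply: eq_bigr => j jk; rewrite ffunE (negbTE jk) addn0.
Qed.

Lemma joint_gfE d : joint_gf M Z d z = \int[P]_w (f (X w) * ((X w).2 == d)%:R).
Proof.
rewrite /joint_gf unlock /Rintegral; congr fine; apply: eq_integral => w _ /=.
congr (_ * _)%:E.
  by apply: eq_bigr => k _; rewrite ffunE.
by rewrite indicE; congr (nat_of_bool _)%:R; apply/idP/eqP; rewrite inE.
Qed.

Lemma joint_gf_balance_bound d :
  `|\sum_l joint_gf M Z l z * env_gen S l d| <=
  \sum_k (\sum_e arrival S k e + \sum_e service_rate S k e) * (1 - z k).
Proof.
pose h (x : state) : R := f x * (x.2 == d)%:R.
have h01 x : 0 <= h x <= 1.
  have /andP[f0 f1] := f01 x.
  by rewrite /h; case: eqP => _; rewrite ?mulr1 ?mulr0 ?f0 ?lexx ?ler01.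
pose jump k x := arrival S k x.2 * (h (add_customer k x) - h x) +
  service_rate S k x.2 * dps_share S k x * (h (remove_customer k x) - h x).
have h_add k x : h (add_customer k x) = h x * z k.
  by rewrite /h f_add /= mulrAC.
have jump_le k x : `|jump k x| <=
    (\sum_e arrival S k e + \sum_e service_rate S k e) * (1 - z k).
  have /andP[z0 z1] := z01 k.
  have diff_le y : `|h (add_customer k y) - h y| <= 1 - z k.
    have /andP[h0 h1] := h01 y.
    rewrite h_add -{2}[h y]mulr1 -mulrBr normrM ger0_norm// distrC ger0_norm ?subr_ge0//.
    by rewrite ler_piMl ?subr_ge0.
  rewrite mulrDl (le_trans (ler_normD _ _))// lerD//.
    by rewrite normrM ger0_norm// ler_pM// ler_sum_term.
  have [xk|xk] := eqVneq (x.1 k) 0%N.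
    by rewrite dps_share0// mulr0 mul0r normr0 mulr_ge0 ?subr_ge0// sumr_ge0.
  have rate0 : 0 <= service_rate S k x.2 * dps_share S k x.
    by apply: mulr_ge0 => //; exact: dps_share_ge0.
  rewrite normrM ger0_norm//; apply: ler_pM => //.
    apply: (@le_trans _ _ (service_rate S k x.2)); last exact: ler_sum_term.
    by apply: ler_piMr => //; exact: dps_share_le1.
  (* A departure reverses an arrival into [remove_customer k x], so the arrival estimate applies. *)
  by rewrite distrC -{1}(remove_customerK xk) diff_le.
(* The diagonal term can be restored because its increment of [h] is zero; the zero row sums then
   cancel the [- h x] contribution. *)
have env x : \sum_l (if x.2 != l then env_gen S x.2 l else 0) * (h (x.1, l) - h x)
    = f x * env_gen S x.2 d.
  have -> : \sum_l (if x.2 != l then env_gen S x.2 l else 0) * (h (x.1, l) - h x)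
      = \sum_l env_gen S x.2 l * (h (x.1, l) - h x).
    apply: eq_bigr => l _; case: eqVneq => // <-.
    by rewrite -surjective_pairing subrr !mulr0.
  under eq_bigr do rewrite mulrBr.
  rewrite sumrB -mulr_suml gen_sum0 mul0r subr0 (bigD1 d)//= big1 => [|l ld].
    by rewrite addr0 /h /= eqxx mulr1 mulrC.
  by rewrite /h/= (negbTE ld) !mulr0.
have genE x : \sum_i dps_intensity S i x * (h (dps_target i x) - h x) =
    \sum_k jump k x + f x * env_gen S x.2 d.
  by rewrite !big_sumType/= env -big_split.
have jumpC x : `|\sum_k jump k x| <=
    \sum_k (\sum_e arrival S k e + \sum_e service_rate S k e) * (1 - z k).
  by rewrite (le_trans (ler_norm_sum _ _ _))// ler_sum.
have int_jump := integrable_discrete_comp P mX jumpC.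
(* A general [g] covers the indicator of one environment state, its multiple by a generator entry,
   and a whole column of the generator. *)
have int_f (g : 'I_D -> R) :
    P.-integrable setT (EFin \o ((fun x => f x * g x.2) \o X)).
  apply: (integrable_discrete_comp P mX (C := \sum_e `|g e|)) => x.
  have /andP[f0 f1] := f01 x.
  rewrite normrM ger0_norm// (@le_trans _ _ `|g x.2|) ?ler_piMl//.
  exact: (ler_sum_term (F := fun e => `|g e|)).
have gfE : \sum_l joint_gf M Z l z * env_gen S l d =
    \int[P]_w (f (X w) * env_gen S (X w).2 d).
  under eq_bigr => l _.
    rewrite joint_gfE -RintegralZr//; last exact: (int_f (fun e => (e == l)%:R)).
    over.
  rewrite -Rintegral_sum => [|l].
    apply: eq_Rintegral => w _; rewrite (bigD1 (X w).2)//= eqxx mulr1 big1 ?addr0//.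
    by move=> l lw; rewrite eq_sym (negbTE lw) mulr0 mul0r.
  rewrite (_ : (fun w => _) = (fun x => f x * ((x.2 == l)%:R * env_gen S l d)) \o X).
    exact: (int_f (fun e => (e == l)%:R * env_gen S l d)).
  by apply/funext => w /=; rewrite mulrA.
have := @stationary_generator _ _ _ _ P X mX _ _ _ _ (dps_rateE S)
  dps_intensity_ge0 dps_intensity_bounded (dps_rate_diag S) steady.2 h h01.
under eq_Rintegral do rewrite genE.
rewrite RintegralD//; last exact: (int_f (fun e => env_gen S e d)).
(* The environment balance is minus the mean of the jump terms, which are bounded pointwise by
   [jumpC]. *)
rewrite -gfE => /eqP; rewrite addrC addr_eq0 => /eqP ->.
rewrite normrN (le_trans (le_normr_Rintegral _ _))//.
set B := leRHS; have <- : \int[P]_w B = B.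
  by have := congr1 fine (expectation_cst P B); rewrite unlock.
apply: le_Rintegral => //.
- apply: (integrable_discrete_comp P mX (g := fun x => `|\sum_k jump k x|)) => x.
  by rewrite normr_id; exact: jumpC.
- exact: finite_measure_integrable_cst.
Qed.

End dps_generating_function.

(** * Passage to the heavy-traffic limit *)

Lemma cvg_sumr {R : numFieldType} {I : Type} (r : seq I) (u : I -> nat -> R)
    (a : I -> R) : (forall i, u i n @[n --> \oo] --> a i) ->
  (\sum_(i <- r) u i n) @[n --> \oo] --> \sum_(i <- r) a i.
Proof.
move=> ua; elim: r => [|i r IH].
  by under eq_cvg do rewrite big_nil; rewrite big_nil; exact: cvg_cst.
under eq_cvg do rewrite big_cons.
by rewrite big_cons; exact: cvgD.
Qed.

Lemma cvg_divn {R : realType} (C : R) : (C / n%:R) @[n --> \oo] --> (0 : R).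
Proof.
have : (C * harmonic n) @[n --> \oo] --> C * 0.
  by apply: cvgM; [exact: cvg_cst|exact: cvg_harmonic].
(* [harmonic n] is the inverse of [n + 1], hence the shift by one. *)
by rewrite mulr0 -[X in _ -> X]cvg_shiftS.
Qed.

Theorem proposition5p2 (R : realType) (K D : nat)
    (hK : (0 < K)%N) (hD : (0 < D)%N)
    (S : dps_params R K D) (pi : 'rV[R]_D)
    (hgen : is_generator (env_gen S))
    (hirr : irreducible_generator (env_gen S))
    (hpi : invariant_distribution pi (env_gen S))
    (harr : forall k d, 0 <= arrival S k d)
    (harr_pos : forall k, exists d, 0 < arrival S k d)
    (hmu : forall k, 0 < mu S k)
    (hweight : forall k, 0 < weight S k)
    (hcap : forall d, 0 < capacity S d)
    (disp : nat -> measure_display)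
    (Omega : forall N, measurableType (disp N))
    (P : forall N, probability (Omega N) R)
    (M : forall N, 'I_K -> {RV (P N) >-> nat})
    (Z : forall N, Omega N -> 'I_D)
    (hsteady : forall N, (1 < N)%N ->
      steady_state (M N) (Z N) (scaled_params pi S N))
    (Phat : 'I_D -> ('I_K -> R) -> R)
    (hlim : forall d (s : 'I_K -> R), (forall k, 0 <= s k) ->
      joint_gf (M N) (Z N) d (fun k => expR (- s k / N%:R)) @[N --> \oo]
        --> Phat d s) :
  forall d (s : 'I_K -> R), (forall k, 0 <= s k) ->
    Phat d s = pi 0 d * \sum_l Phat l s.
Proof.
move=> d s s0.
pose v : 'rV[R]_D := \row_l Phat l s.
suff vQ : v *m env_gen S = 0.
  have /rowP/(_ d) := invariant_unique hgen hirr hpi vQ.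
  rewrite !mxE mulrC => ->; congr (_ * _).
  by apply: eq_bigr => l _; rewrite mxE.
have [gen_ge0 gen_sum0] := hgen.
have [pi_ge0 _ _] := hpi.
(* This keeps the scaled arrival rates nonnegative, as [joint_gf_balance_bound] requires. *)
have rho_ge0 : 0 <= rho_inf pi S.
  apply: sumr_ge0 => k _; apply: divr_ge0.
    by apply: sumr_ge0 => e _; exact: mulr_ge0.
  apply: mulr_ge0; first exact: ltW.
  by apply: sumr_ge0 => e _; apply: mulr_ge0 => //; exact: ltW.
apply/rowP => e; rewrite !mxE.
under eq_bigr do rewrite mxE.
pose gf N l := joint_gf (M N) (Z N) l (fun k => expR (- s k / N%:R)).
(* [C / N] is the balance bound with the load factor [1 - 1 / N] enlarged to 1 and [1 - z k]
   enlarged to [s k / N]. *)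
pose C := \sum_k (\sum_l arrival S k l / rho_inf pi S +
                  \sum_l service_rate S k l) * s k.
have gf_bound N : (1 < N)%N ->
    `|\sum_l gf N l * env_gen S l e| <= C / N%:R.
  move=> N1; have N0 : (0 : R) < N%:R by rewrite ltr0n (ltn_trans _ N1).
  have invN_ge0 : (0 : R) <= N%:R^-1 by rewrite invr_ge0 ltW.
  have invN_le1 : N%:R^-1 <= 1 :> R by rewrite invf_le1// ler1n ltnW.
  (* The tangent inequality for the exponential at 0 makes [1 - z k] of order [1 / N]. *)
  have z_ge k : 1 - s k / N%:R <= expR (- s k / N%:R).
    by rewrite mulNr expR_ge1Dx.
  have z01 k : 0 <= expR (- s k / N%:R) <= 1.
    by rewrite expR_ge0 /= -expR0 ler_expR mulNr oppr_le0 divr_ge0// ltW.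
  apply: (le_trans (joint_gf_balance_bound _ _ _ _ _ _ (hsteady N N1) z01 e)) => //=.
  - by move=> k l; rewrite !mulr_ge0// ?invr_ge0// subr_ge0 div1r.
  - by move=> k; exact: ltW.
  - by move=> k; exact: ltW.
  - by move=> k; exact: ltW.
  rewrite /C mulr_suml; apply: ler_sum => k _.
  rewrite -mulrA; apply: ler_pM.
  - apply: addr_ge0; apply: sumr_ge0 => l _; last first.
      by apply: mulr_ge0 => /=; exact: ltW.
    by rewrite !mulr_ge0// ?invr_ge0// subr_ge0 div1r.
  - by rewrite subr_ge0; case/andP: (z01 k).
  - rewrite lerD2r; apply: ler_sum => l _.
    by rewrite ler_piMr ?divr_ge0// div1r gerBl.
  - by rewrite lerBlDr -lerBlDl z_ge.
have lim_sum : (\sum_l gf N l * env_gen S l e) @[N --> \oo] -->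
    \sum_l Phat l s * env_gen S l e.
  apply: cvg_sumr => l; apply: cvgM; [exact: hlim|exact: cvg_cst].
have lim0 : (\sum_l gf N l * env_gen S l e) @[N --> \oo] --> (0 : R).
  apply: norm_cvg0.
  apply: (squeeze_cvgr _ (cvg_cst 0) (cvg_divn C)).
  (* Stationarity is assumed only for [1 < N], so the squeeze starts at 2. *)
  exists 2%N => // N /= N1; rewrite normr_ge0/=; exact: gf_bound.
exact: (cvg_unique _ lim_sum lim0).
Qed.
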